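(* Let $s^*\le 1$, $\alpha\in(0,1)$, let $X_1,X_2,\dots$ be i.i.d. real random variables with continuous distribution function $F$, and for each $n$ let $(L_n,U_n)$ be a $(1-\alpha)$-confidence band for $F$ based on $X_1,\dots,X_n$, with refined band $(L_n^o,U_n^o)$ for the class $\mathcal{P}_{s^*}$ of bi-$s^*$-concave distribution functions. Suppose that $(L_n,U_n)$ is consistent in the sense that for any fixed $x\in\mathbb{R}$ both $L_n(x)$ and $U_n(x)$ tend to $F(x)$ in probability as $n\to\infty$. (i) Suppose that $F\notin\mathcal{P}_{s^*}$. Then $P(L_n^o\le U_n^o)\to0$. (ii) Suppose that $F\in\mathcal{P}_{s^*}$ with $s^*\ne0$, and write $f=F'$ on $J(F)=\{x:0<F(x)<1\}$. Then $P(L_n^o\le U_n^o)\ge1-\alpha$, and $$\sup_{G\in\mathcal{P}_{s^*}:L_n\le G\le U_n}\|G-F\|_\infty\to_p0,$$ where $\sup(\emptyset)=0$. Moreover, for any compact interval $K\subset J(F)$, $$\sup_{G\in\mathcal{P}_{s^*}:L_n\le G\le U_n}\|h_G-h_F\|_{K,\infty}\to_p0,$$ where $h_G$ stands for any of the three functions $G'$, $(G^{s^*})'$ and $((1-G)^{s^*})'$. Finally, for any fixed $x_1\in J(F)$ and $0<b_1<f(x_1)/F^{1-s^*}(x_1)$, $$P\Big(U_n^o(x)\le\big(U_n^{s^*}(x')+s^*b_1(x-x')\big)_+^{1/s^*}\text{ for all }x\le x'\le x_1\Big)\to1,$$ while for any fixed $x_2\in J(F)$ and $0<b_2<f(x_2)/(1-F(x_2))^{1-s^*}$,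 $$P\Big(1-L_n^o(x)\le\big((1-L_n(x'))^{s^*}-s^*b_2(x-x')\big)_+^{1/s^*}\text{ for all }x\ge x'\ge x_2\Big)\to1.$$
   Context: For a distribution function $G$ on $\mathbb{R}$ let $J(G)=\{x\in\mathbb{R}:0<G(x)<1\}$. For $s^*\in(-\infty,1]$, $G$ is bi-$s^*$-concave if $G$ is continuous on $\mathbb{R}$ and, on $J(G)$: for $s^*<0$, both $G^{s^*}$ and $(1-G)^{s^*}$ are convex; for $s^*=0$, both $\log G$ and $\log(1-G)$ are concave; for $0<s^*\le 1$, both $G^{s^*}$ and $(1-G)^{s^*}$ are concave. A bi-$s^*$-concave $G$ is known to be differentiable on $J(G)$. $\mathcal{P}_{s^*}$ denotes the class of bi-$s^*$-concave distribution functions. A $(1-\alpha)$-confidence band $(L_n,U_n)$ for $F$ consists of non-decreasing functions $L_n,U_n$ on $\mathbb{R}$ depending only on $\alpha$ and $X_1,\dots,X_n$, with $L_n<1$, $U_n>0$, and $P(L_n(x)\le F(x)\le U_n(x)\text{ for all }x\in\mathbb{R})=1-\alpha$. The refined band is $$L_n^o(x)=\inf\{G(x):G\in\mathcal{P}_{s^*},\,L_n\le G\le U_n\},\qquad U_n^o(x)=\sup\{G(x):G\in\mathcal{P}_{s^*},\,L_n\le G\le U_n\};$$ if no $G\in\mathcal{P}_{s^*}$ satisfies $L_n\le G\le U_n$, one sets $L_n^o\equiv1$ and $U_n^o\equiv0$. Inequalities between functions are pointwise on $\mathbb{R}$. Notation: $\|h\|_\infty=\sup_{x\in\mathbb{R}}|h(x)|$,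 $\|h\|_{K,\infty}=\sup_{x\in K}|h(x)|$, $x_+=\max\{x,0\}$, and $\to_p$ denotes convergence in probability as $n\to\infty$. (In the statement about $h_G$ the derivatives on $K$ are defined whenever $K\subset J(G)$, which holds simultaneously for all $G$ in the supremum with probability tending to one.) *)

(* Defs.v *)
From HB Require Import structures.
From mathcomp Require Import all_boot all_order all_algebra finmap.
From mathcomp Require Import all_classical all_reals all_analysis.

Set Implicit Arguments.
Unset Strict Implicit.
Unset Printing Implicit Defensive.

Import Order.TTheory GRing.Theory Num.Theory.
Import numFieldNormedType.Exports.

Local Open Scope classical_set_scope.
Local Open Scope ring_scope.

Section BiConcave.
Context {R : realType}.
Implicit Types (G : R -> R) (D : set R) (s : R).

Definition distribution_function G : Prop :=
  [/\ {homo G : x y / x <= y}, right_continuous G,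
      G x @[x --> -oo] --> (0 : R) & G x @[x --> +oo] --> (1 : R)].

Definition J G : set R := [set x | 0 < G x < 1].

Definition convex_on D (f : R -> R) : Prop :=
  convex_function (D : set (convex_lmodType R^o)) f.

Definition concave_on D (f : R -> R) : Prop := convex_on D (fun x => - f x).

Definition bi_s_concave s G : Prop :=
  [/\ continuous G,
      s < 0 -> convex_on (J G) (fun x => G x `^ s) /\
               convex_on (J G) (fun x => (1 - G x) `^ s),
      s = 0 -> concave_on (J G) (fun x => ln (G x)) /\
               concave_on (J G) (fun x => ln (1 - G x)) &
      0 < s -> concave_on (J G) (fun x => G x `^ s) /\
               concave_on (J G) (fun x => (1 - G x) `^ s)].

Definition Pclass s : set (R -> R) :=
  [set G | distribution_function G /\ bi_s_concave s G].

Definition in_band s (L U : R -> R) : set (R -> R) :=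
  [set G | Pclass s G /\ forall x, L x <= G x <= U x].

Definition refined_lower s (L U : R -> R) (x : R) : R :=
  if `[< in_band s L U !=set0 >] then inf [set G x | G in in_band s L U] else 1.

Definition refined_upper s (L U : R -> R) (x : R) : R :=
  if `[< in_band s L U !=set0 >] then sup [set G x | G in in_band s L U] else 0.

(* The supremum norm is extended-real: nothing bounds it a priori when h is a
   difference of derivatives. *)
Definition supnorm (K : set R) (h : R -> R) : \bar R :=
  ereal_sup [set `|h x|%:E | x in K].

(* ereal_sup set0 is -oo; here the supremum of the empty set is 0. *)
Definition esup0 (S : set (\bar R)) : \bar R :=
  if `[< S !=set0 >] then ereal_sup S else 0%E.

(* The three maps G |-> h_G. Off J(G) the total function derive1 may return a
   meaningless value. *)
Definition h_maps s : set ((R -> R) -> (R -> R)) :=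
  [set (fun G => derive1 G);
       (fun G => derive1 (fun x => G x `^ s));
       (fun G => derive1 (fun x => (1 - G x) `^ s))].

End BiConcave.

Section Probability.
Context {d : measure_display} {T : measurableType d} {R : realType}.
Variable P : probability T R.

(* Events that quantify over the uncountable class of bi-s-concave functions
   need not be measurable, and P has no meaning on non-measurable sets. Hence
   P(A) -> 0 is read with the outer probability mu_ext P, and P(A) -> 1 and
   P(A) >= c with the inner probability; both agree with P on measurable
   sets. *)
Definition inner_prob (A : set T) : \bar R := (1 - mu_ext P (~` A))%E.

Lemma inner_probE (A : set T) : measurable A -> inner_prob A = P A.
Proof.
move=> mA; have mAC := measurableC mA.
by rewrite /inner_prob measurable_mu_extE// -probability_setC// setCK.
Qed.

Definition cvg_in_prob (Z : nat -> T -> \bar R) (z : R) : Prop :=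
  forall e : R, 0 < e ->
    mu_ext P [set w | (e%:E < `|Z n w - z%:E|)%E] @[n --> \oo] --> 0%E.

Definition mutually_independent (X : nat -> {RV P >-> R}) : Prop :=
  forall (I : {fset nat}) (A : nat -> set R), (forall i, measurable (A i)) ->
    P (\bigcap_(i in [set` I]) (X i @^-1` A i))
    = (\prod_(i <- I) P (X i @^-1` A i))%E.

Definition iid_with_cdf (X : nat -> {RV P >-> R}) (F : R -> R) : Prop :=
  mutually_independent X /\ forall i x, cdf (X i) x = (F x)%:E.

Definition sample (X : nat -> {RV P >-> R}) (n : nat) (w : T) : n.-tuple R :=
  [tuple X i w | i < n].

(* L and U are functions of the data; measurability in the data makes L(x) and
   U(x) random variables. As L and U are monotone and F is continuous, the
   coverage event is then measurable. *)
Definition confidence_band (X : nat -> {RV P >-> R}) (F : R -> R) (alpha : R)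
    (n : nat) (L U : n.-tuple R -> R -> R) : Prop :=
  [/\ forall t, {homo L t : x y / x <= y} /\ {homo U t : x y / x <= y},
      forall x, measurable_fun [set: n.-tuple R] (L^~ x) /\
                measurable_fun [set: n.-tuple R] (U^~ x),
      forall t x, L t x < 1 /\ 0 < U t x &
      P [set w | forall x, L (sample X n w) x <= F x <= U (sample X n w) x]
      = (1 - alpha)%:E].

End Probability.

(* Main.v *)
Require Import Defs.
From HB Require Import structures.
From mathcomp Require Import all_boot all_order all_algebra finmap.
From mathcomp Require Import all_classical all_reals all_analysis.
From mathcomp Require Import ring lra.

(** Consistency at finitely many points confines every G in the band to a
    neighbourhood of F in the topology of pointwise convergence, outside an
    event of vanishing outer probability. It thus suffices that each assertion
    holds for all bi-s-concave distribution functions G in some pointwise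
    neighbourhood of F. With phi(t) = t^s / s (ln t if s = 0), bi-s-concavity
    says that phi(G) and phi(1 - G) are concave on J(G). Concavity survives
    pointwise limits, which gives (i). For (ii), difference quotients of
    concave functions bound their derivatives, so (G, x) |-> phi(G)'(x) is
    jointly continuous at (F, x), and compactness makes this uniform on K. The
    last two bounds compare a chord of phi(G), or of phi(1 - G), with the
    derivative at x1, or at x2. *)

Set Implicit Arguments.
Unset Strict Implicit.
Unset Printing Implicit Defensive.

Import Order.TTheory GRing.Theory Num.Theory.
Import numFieldNormedType.Exports.

Local Open Scope classical_set_scope.
Local Open Scope ring_scope.

(** * Derivatives and concavity *)

Section Derivatives.
Context {R : realType}.
Implicit Types (A B G H : R -> R) (x l c : R).

Lemma is_derive_slope_cvg H x l :
  is_derive x 1 H l <-> h^-1 * (H (h + x) - H x) @[h --> 0^'] --> l.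
Proof.
have E : (fun h => h^-1 * (H (h + x) - H x))
       = (fun h => h^-1 *: ((H \o shift x) h%:A - H x)).
  by apply/funext => h; rewrite /= [h%:A]mulr1.
split=> [[dH <-]|cH]; first by rewrite E; exact: ex_derive.
have dH : derivable H x 1 by rewrite /derivable -E; apply/cvg_ex; exists l.
by apply: DeriveDef => //; rewrite /derive -E; exact/cvg_lim.
Qed.

Lemma is_derive_le_right H x l c : is_derive x 1 H l ->
  (\forall h \near 0^'+, H (h + x) - H x <= c * h) -> l <= c.
Proof.
move=> /is_derive_slope_cvg/cvg_dnbhs_at_right cH Hc.
apply: (cvgr_to_le cH); near=> h.
have h0 : 0 < h by near: h; exact: nbhs_right_gt.
by rewrite ler_pdivrMl// mulrC; near: h.
Unshelve. all: by end_near. Qed.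

Lemma is_derive_ge_left H x l c : is_derive x 1 H l ->
  (\forall h \near 0^'-, H (h + x) - H x <= c * h) -> c <= l.
Proof.
move=> /is_derive_slope_cvg/cvg_dnbhs_at_left cH Hc.
apply: (cvgr_to_ge cH); near=> h.
have h0 : h < 0 by near: h; exact: nbhs_left_lt.
by rewrite ler_ndivlMl// mulrC; near: h.
Unshelve. all: by end_near. Qed.

(** [G] is not assumed differentiable. The two bounds touch at [x], so they share their derivative
    there, and the difference quotients of [G] lie between theirs. *)
Lemma squeeze_is_derive A B G x a b : A x = G x -> B x = G x ->
  (\forall y \near x, B y <= G y <= A y) ->
  is_derive x 1 A a -> is_derive x 1 B b -> is_derive x 1 G a.
Proof.
move=> Ax Bx BGA dA dB.
have shiftx : h + x @[h --> (0 : R)] --> x.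
  by rewrite -[X in _ --> X]add0r; apply: cvgD; [exact: cvg_id|exact: cvg_cst].
have nearh : \forall h \near (0 : R), B (h + x) <= G (h + x) <= A (h + x).
  exact: shiftx _ BGA.
(* [B - A] vanishes at [x] and is nonpositive nearby: a local maximum, so its derivative there is
   both [<= 0] and [>= 0]. *)
have BA : \forall h \near (0 : R), (B - A) (h + x) - (B - A) x <= 0 * h.
  apply: filterS nearh => h /andP[/le_trans] /[apply].
  by rewrite !fctE Ax Bx subrr subr0 mul0r subr_le0.
have ab : b = a.
  have dBA := is_deriveB dB dA.
  apply/eqP; rewrite -subr_eq0 eq_le (is_derive_le_right dBA) ?(is_derive_ge_left dBA)//.
    exact: cvg_within BA.
  exact: cvg_within BA.
rewrite {b}ab in dB.
move/is_derive_slope_cvg : dA => dA; move/is_derive_slope_cvg : dB => dB.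
apply/is_derive_slope_cvg/cvgrPdist_le => e e0.
move/cvgrPdist_le : dA => /(_ _ e0) dA; move/cvgrPdist_le : dB => /(_ _ e0) dB.
near=> h.
have h0 : h != 0 by near: h; exact: nbhs_dnbhs_neq.
have : `|a - h^-1 * (A (h + x) - A x)| <= e by near: h.
have : `|a - h^-1 * (B (h + x) - B x)| <= e by near: h.
have /andP[] : B (h + x) <= G (h + x) <= A (h + x).
  by near: h; exact: nbhs_dnbhs nearh.
rewrite Ax Bx -(lerD2r (- G x)) -(lerD2r (- G x) (G (h + x))) !ler_norml.
move: (B _ - _) (G _ - _) (A _ - _) => u v w uv vw /andP[u1 u2] /andP[w1 w2].
(* Dividing by a negative [h] exchanges the roles of the two bounds. *)
have [h_gt0|h_lt0|h00] := ltgtP 0 h; last by rewrite h00 eqxx in h0.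
- have : h^-1 * u <= h^-1 * v by rewrite ler_pM2l ?invr_gt0.
  have : h^-1 * v <= h^-1 * w by rewrite ler_pM2l ?invr_gt0.
  by move=> ? ?; apply/andP; split; lra.
- have : h^-1 * v <= h^-1 * u by rewrite ler_nM2l ?invr_lt0.
  have : h^-1 * w <= h^-1 * v by rewrite ler_nM2l ?invr_lt0.
  by move=> ? ?; apply/andP; split; lra.
Unshelve. all: by end_near. Qed.

End Derivatives.

(** * Chord slopes of concave functions *)

Section ChordConcave.
Context {R : realType}.
Implicit Types (D : set R) (H : R -> R).

Definition chord H (u v : R) : R := (H v - H u) / (v - u).

Definition chord_concave D H := forall u v w : R, D u -> D w -> u < v < w ->
  chord H v w <= chord H u v.

Lemma concave_onP D H : concave_on D H <->
  forall t x y : R, 0 <= t <= 1 -> D x -> D y ->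
    t * H x + (1 - t) * H y <= H (t * x + (1 - t) * y).
Proof.
split=> [cH t x y /andP[t0 t1] Dx Dy|cH t x y].
  rewrite -lerN2 opprD -!mulrN.
  by have := cH (Itv01 t0 t1) x y; apply; rewrite inE.
rewrite !inE => Dx Dy; have t01 : 0 <= t%:num <= 1 by rewrite ge0 le1.
by have := cH t%:num x y t01 Dx Dy; rewrite -lerN2 opprD -!mulrN.
Qed.

(** The point [v] is the convex combination of [u] and [w] with weight [(w - v) / (w - u)] on [u].
    With denominators cleared, the concavity inequality at [v] is the slope inequality. *)
Lemma concave_on_chord D H : concave_on D H -> chord_concave D H.
Proof.
move=> /concave_onP cH u v w Du Dw /andP[uv vw].
have uw : u < w by exact: lt_trans vw.
have t01 : 0 <= (w - v) / (w - u) <= 1.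
  rewrite divr_ge0 ?subr_ge0 ?(ltW vw) ?(ltW uw)//=.
  by rewrite ler_pdivrMr ?subr_gt0// mul1r lerD2l lerN2 ltW.
have := cH ((w - v) / (w - u)) u w t01 Du Dw.
have -> : (w - v) / (w - u) * u + (1 - (w - v) / (w - u)) * w = v.
  by field; rewrite subr_eq0 gt_eqF.
have -> : (w - v) / (w - u) * H u + (1 - (w - v) / (w - u)) * H w
    = ((w - v) * H u + (v - u) * H w) / (w - u).
  by field; rewrite subr_eq0 gt_eqF.
rewrite ler_pdivrMr ?subr_gt0// => K.
rewrite /chord ler_pdivrMr ?subr_gt0// mulrAC ler_pdivlMr ?subr_gt0//.
by nra.
Qed.

Lemma chord_concave_le D H a b c d : is_interval D -> chord_concave D H ->
  D a -> D d -> a < b -> b <= c -> c < d -> chord H c d <= chord H a b.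
Proof.
move=> iD cH Da Dd ab bc cd.
have Dc : D c by apply: (iD a d) => //; rewrite (ltW cd) (ltW (lt_le_trans ab bc)).
move: bc; rewrite le_eqVlt => /predU1P[bc|bc].
  by rewrite -bc in cd *; apply: cH => //; rewrite ab cd.
have Db : D b by apply: (iD a d) => //; rewrite (ltW ab) (ltW (lt_trans bc cd)).
by apply: (@le_trans _ _ (chord H b c)); apply: cH => //; apply/andP.
Qed.

(** For small [h > 0] the chord from [x] to [x + h] lies to the right of [[a, b]], so its slope is
    at most [chord H a b]; let [h] tend to 0. The point [w] of [D] beyond [x] keeps [x + h] inside
    [D]. *)
Lemma derive_le_chord D H a b x w l : is_interval D -> chord_concave D H ->
  D a -> D w -> a < b -> b <= x -> x < w -> is_derive x 1 H l ->
  l <= chord H a b.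
Proof.
move=> iD cH Da Dw ab bx xw /is_derive_le_right; apply; near=> h.
have h0 : 0 < h by near: h; exact: nbhs_right_gt.
have hw : h + x <= w.
  by rewrite -lerBrDr; near: h; apply: nbhs_right_le; rewrite subr_gt0.
have xh : x < h + x by rewrite ltrDr.
have ax : a <= h + x by rewrite (le_trans (ltW ab))// (le_trans bx)// ltW.
have Dh : D (h + x) by apply: (iD a w) => //; rewrite ax hw.
have := chord_concave_le iD cH Da Dh ab bx xh.
by rewrite {1}/chord addrK ler_pdivrMr.
Unshelve. all: by end_near. Qed.

(** Mirror image of [derive_le_chord], with chords from [x + h] to [x] for small [h < 0]. *)
Lemma chord_le_derive D H a b x w l : is_interval D -> chord_concave D H ->
  D w -> D b -> w < x -> x <= a -> a < b -> is_derive x 1 H l ->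
  chord H a b <= l.
Proof.
move=> iD cH Dw Db wx xa ab /is_derive_ge_left; apply; near=> h.
have h0 : h < 0 by near: h; exact: nbhs_left_lt.
have hw : w <= h + x.
  by rewrite -lerBlDr; near: h; apply: nbhs_left_ge; rewrite subr_lt0.
have xh : h + x < x by rewrite gtrDr.
have bx : h + x <= b by rewrite (le_trans _ (ltW ab))// (le_trans _ xa)// ltW.
have Dh : D (h + x) by apply: (iD w b) => //; rewrite hw bx.
have := chord_concave_le iD cH Dh Db xh xa ab.
rewrite {2}/chord opprD addrA addrAC subrr add0r invrN mulrN -mulNr opprB.
by rewrite ler_ndivlMr.
Unshelve. all: by end_near. Qed.

(** The supremum of the chord slopes to the right of [x] works: every chord slope to the left of [x]
    bounds it from above. *)
Lemma chord_concave_supergradient D H u x w : is_interval D ->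
  chord_concave D H -> D u -> D w -> u < x < w ->
  exists p, forall y, D y -> H y <= H x + p * (y - x).
Proof.
move=> iD cH Du Dw /andP[ux xw].
pose S := [set chord H x y | y in [set y | D y /\ x < y]].
have S0 : S !=set0 by exists (chord H x w), w.
have ubS z : D z -> z < x -> ubound S (chord H z x).
  by move=> Dz zx _ [y [Dy xy] <-]; apply: cH => //; apply/andP.
have bS : has_ubound S by exists (chord H u x); exact: ubS.
exists (sup S) => y Dy; rewrite -lerBlDl.
have [xy|yx|->] := ltgtP x y; last by rewrite !subrr mulr0.
- rewrite -ler_pdivrMr ?subr_gt0//; apply: ub_le_sup => //.
  by exists y.
- have : sup S <= chord H y x by apply: ge_sup => //; exact: ubS.
  by rewrite /chord ler_pdivlMr ?subr_gt0// => ?; nra.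
Qed.

End ChordConcave.

(** * The scale phi and bi-s-concave distribution functions *)

Section PowerScale.
Context {R : realType}.
Implicit Types (s t u : R).

(* Dividing by s makes the scale increasing for every s, so that the convexity
   (s < 0) and concavity (s >= 0) requirements on G^s, (1 - G)^s and on the
   logarithms all become concavity. *)
Definition phi s t : R := if s == 0 then ln t else t `^ s / s.

Lemma is_derive_phi s t : 0 < t -> is_derive t 1 (phi s) (t `^ (s - 1)).
Proof.
move=> t0; have [->|s0] := eqVneq s 0.
  rewrite sub0r powR_inv1 ?ltW//.
  have -> : phi 0 = @ln R by apply/funext => u; rewrite /phi eqxx.
  exact: is_derive1_ln.
have -> : phi s = s^-1 \*: (fun u => u `^ s).
  by apply/funext => u; rewrite /phi (negbTE s0) /= mulrC.
have -> : t `^ (s - 1) = s^-1 *: (s * t `^ (s - 1)) by rewrite scalerA mulVf// scale1r.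
by apply: is_deriveZ; exact: is_derive1_powR.
Qed.

Lemma phi_continuous s t : 0 < t -> {for t, continuous (phi s)}.
Proof.
move=> /(is_derive_phi s) dt; apply/differentiable_continuous/derivable1_diffP.
exact: ex_derive.
Qed.

Lemma ge_powR_neg s t u : s <= 0 -> 0 < t -> t <= u -> u `^ s <= t `^ s.
Proof.
move=> s0 t0 tu; have u0 := lt_le_trans t0 tu; rewrite -(opprK s) powRN [leRHS]powRN.
rewrite lef_pV2 ?posrE ?powR_gt0//.
by apply: ge0_ler_powR; rewrite ?oppr_ge0 ?nnegrE ?(ltW t0) ?(ltW u0).
Qed.

Lemma ler_phi s t u : 0 < t -> t <= u -> phi s t <= phi s u.
Proof.
move=> t0 tu; have u0 := lt_le_trans t0 tu.
rewrite /phi; case: (ltgtP s 0) => [s0|s0|_]; last by rewrite ler_ln ?posrE.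
- rewrite ler_nM2r ?invr_lt0//; exact: ge_powR_neg (ltW s0) t0 tu.
- rewrite ler_pM2r ?invr_gt0//.
  by apply: ge0_ler_powR; rewrite ?nnegrE ?(ltW s0) ?(ltW t0) ?(ltW u0).
Qed.

Lemma powRK s t : s != 0 -> 0 < t -> (t `^ s) `^ s^-1 = t.
Proof. by move=> s0 t0; rewrite -powRrM mulfV// powRr1// ltW. Qed.

(** For [s < 0], multiplying by [s] and raising to the power [s^-1] each reverse the inequality, so
    its direction survives. *)
Lemma le_phi_inv s t u c : s != 0 -> 0 < t -> 0 < u `^ s + s * c ->
  phi s t <= phi s u + c -> t <= (u `^ s + s * c) `^ s^-1.
Proof.
move=> s0 t0 A0; rewrite /phi (negbTE s0) => tuc.
rewrite -{1}(powRK s0 t0).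
move: s0; rewrite neq_lt => /orP[s_lt0|s_gt0].
- apply: ge_powR_neg => //; first by rewrite invr_le0 ltW.
  move: tuc; rewrite ler_ndivrMr// mulrDl mulfVK ?(lt_eqF s_lt0)//.
  by rewrite [c * s]mulrC.
- apply: ge0_ler_powR; rewrite ?nnegrE ?invr_ge0 ?powR_ge0 ?(ltW s_gt0) ?(ltW A0)//.
  move: tuc; rewrite ler_pdivrMr// mulrDl mulfVK ?(gt_eqF s_gt0)//.
  by rewrite [c * s]mulrC.
Qed.

(** Gives the form of the bounds on the refined band: [v] is a value of the original band function
    and the maximum is the positive part. *)
Lemma le_phi_inv_max s t u v c : s != 0 -> 0 < t -> 0 < u -> u <= v ->
  (s < 0 -> c <= 0) -> phi s t <= phi s u + c ->
  t <= Num.max (v `^ s + s * c) 0 `^ s^-1.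
Proof.
move=> s0 t0 u0 uv sc tuc.
have v0 := lt_le_trans u0 uv.
have tvc : phi s t <= phi s v + c by rewrite (le_trans tuc)// lerD2r ler_phi.
have A0 : 0 < v `^ s + s * c.
  have ts0 : 0 < t `^ s by exact: powR_gt0.
  have vs0 : 0 < v `^ s by exact: powR_gt0.
  move: (s0); rewrite neq_lt => /orP[s_lt0|s_gt0].
    by rewrite ltr_wpDr// nmulr_rge0// sc.
  move: tvc; rewrite /phi (negbTE s0) ler_pdivrMr// mulrDl mulfVK//.
  by rewrite [c * s]mulrC; exact: lt_le_trans.
by rewrite max_l ?(ltW A0)//; exact: le_phi_inv.
Qed.

(** A supporting line of [phi s \o H] at [x], pulled back through the inverse of [phi s], is a
    differentiable function that touches [H] at [x] and lies above it nearby. *)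
Lemma phi_concave_majorant s (D : set R) (H : R -> R) (u x w : R) : s != 0 ->
  is_interval D -> chord_concave D (phi s \o H) ->
  (forall y, D y -> 0 < H y) -> D u -> D w -> u < x < w ->
  exists A a, [/\ is_derive x 1 A a, A x = H x &
    \forall y \near x, H y <= A y].
Proof.
move=> s0 iD cH Hgt0 Du Dw uxw; have /andP[ux xw] := uxw.
have Dx : D x by apply: (iD u w) => //; rewrite (ltW ux) (ltW xw).
have [p Hp] := chord_concave_supergradient iD cH Du Dw uxw.
(* [A0] is [s] times the supporting line, so [A0] to the power [s^-1] is its pull-back. *)
pose A0 y := H x `^ s + s * (p * (y - x)).
have A0x : A0 x = H x `^ s by rewrite /A0 subrr !mulr0 addr0.
have dA0 : is_derive x 1 A0 (s * p).
  have -> : A0 = cst (H x `^ s) + (s * p) \*: (id - cst x).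
    by apply/funext => y; rewrite !fctE /= /A0 mulrA.
  have dI : is_derive x 1 (id - cst x : R -> R) (1 - 0) by exact: is_deriveB.
  have := is_deriveD (is_derive_cst (H x `^ s) x 1) (is_deriveZ (s * p) dI).
  by rewrite add0r subr0 [_ *: 1]mulr1.
have A0x0 : 0 < A0 x by rewrite A0x powR_gt0// Hgt0.
have dP : is_derive (A0 x) 1 (fun t => t `^ s^-1) (s^-1 * A0 x `^ (s^-1 - 1)).
  exact: is_derive1_powR.
exists ((fun t => t `^ s^-1) \o A0), (s^-1 * A0 x `^ (s^-1 - 1) * (s * p)); split.
- exact: is_derive1_comp.
- by rewrite /= A0x powRK// Hgt0.
have cA0 : {for x, continuous A0}.
  by apply/differentiable_continuous/derivable1_diffP; exact: ex_derive.
(* Closeness to [x] keeps [y] in the interval [D] and, by continuity, [A0 y] positive. *)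
near=> y.
have Dy : D y.
  apply: (iD u w) => //; apply/andP; split; near: y;
    [exact: lt_le_nbhsr|exact: lt_le_nbhsl].
apply: le_phi_inv => //; [exact: Hgt0| |exact: Hp].
near: y; exact: (cvgr_gt _ cA0).
Unshelve. all: by end_near. Qed.

End PowerScale.

(** * Bi-s-concave distribution functions *)

Section BiConcaveClass.
Context {R : realType}.
Implicit Types (F G : R -> R) (D : set R) (s x : R).

Lemma distribution_function_ge0 G x : distribution_function G -> 0 <= G x.
Proof.
move=> [Gle _ GN _]; apply: (cvgr_to_le GN); near=> y.
by apply: Gle; near: y; apply: nbhs_ninfty_le; exact: num_real.
Unshelve. all: by end_near. Qed.

Lemma distribution_function_le1 G x : distribution_function G -> G x <= 1.
Proof.
move=> [Gle _ _ GY]; apply: (cvgr_to_ge GY); near=> y.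
by apply: Gle; near: y; apply: nbhs_pinfty_ge; exact: num_real.
Unshelve. all: by end_near. Qed.

Lemma J_interval G : {homo G : x y / x <= y} -> is_interval (J G).
Proof.
move=> Gle x y /andP[x0 x1] /andP[y0 y1] z /andP[xz zy]; apply/andP; split.
  by rewrite (lt_le_trans x0)// Gle.
by rewrite (le_lt_trans _ y1)// Gle.
Qed.

Lemma near_J G x : {for x, continuous G} -> J G x -> \forall y \near x, J G y.
Proof.
move=> cG /andP[x0 x1]; near=> y; apply/andP; split; near: y.
  exact: (cvgr_gt _ cG).
exact: (cvgr_lt _ cG).
Unshelve. all: by end_near. Qed.

Lemma near_flank (Q : set R) x : (\forall y \near x, Q y) ->
  exists u w, [/\ Q u, Q w & u < x < w].
Proof.
move=> /nbhs_ballP[e /= e0 xQ]; exists (x - e / 2), (x + e / 2).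
have e2 : `|e / 2| < e.
  by rewrite ger0_norm ?divr_ge0 ?ltW// ltr_pdivrMr// ltr_pMr// ltr1n.
split.
- by apply: xQ; rewrite /ball /= opprB addrC subrK.
- by apply: xQ; rewrite /ball /= opprD addrA subrr add0r normrN.
- by rewrite ltrBlDr !ltrDl divr_gt0.
Qed.

Lemma convex_onZ D k (f : R -> R) : 0 < k ->
  convex_on D (fun x => k * f x) <-> convex_on D f.
Proof.
move=> k0; have E t (u v : R) :
    t * (k * u) + (1 - t) * (k * v) = k * (t * u + (1 - t) * v) by ring.
split=> cf t x y xD yD; have := cf t x y xD yD; rewrite !convRE E.
- by rewrite ler_pM2l.
- by rewrite ler_pM2l.
Qed.

Lemma bi_s_concaveP s G : bi_s_concave s G <->
  [/\ continuous G, concave_on (J G) (phi s \o G)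
    & concave_on (J G) (fun x => phi s (1 - G x))].
Proof.
have phi_lt0 (H : R -> R) : s < 0 ->
    concave_on (J G) (fun x => phi s (H x)) <-> convex_on (J G) (fun x => H x `^ s).
  move=> s0; rewrite /concave_on.
  have -> : (fun x => - phi s (H x)) = (fun x => (- s)^-1 * H x `^ s).
    by apply/funext => x; rewrite /phi lt_eqF// invrN mulNr mulrC.
  by apply: convex_onZ; rewrite invr_gt0 oppr_gt0.
have phi_gt0 (H : R -> R) : 0 < s ->
    concave_on (J G) (fun x => phi s (H x)) <-> concave_on (J G) (fun x => H x `^ s).
  move=> s0; rewrite /concave_on.
  have -> : (fun x => - phi s (H x)) = (fun x => s^-1 * - H x `^ s).
    by apply/funext => x; rewrite /phi gt_eqF// mulrN mulrC.
  by apply: convex_onZ; rewrite invr_gt0.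
split=> [[cG neg zero pos]|[cG c1 c2]].
  have [s0|s0|s0] := ltgtP s 0.
  - by have [? ?] := neg s0; split => //; exact/phi_lt0.
  - by have [? ?] := pos s0; split => //; exact/phi_gt0.
  - have [? ?] := zero s0.
    have E : phi s = @ln R by apply/funext => x; rewrite /phi s0 eqxx.
    by split; rewrite ?E.
split=> // s0.
- by split; apply/phi_lt0.
- have E : phi s = @ln R by apply/funext => x; rewrite /phi s0 eqxx.
  by rewrite E in c1 c2.
- by split; apply/phi_gt0.
Qed.

Section Pclass.
Variables (s : R) (G : R -> R).
Hypothesis sG : Pclass s G.

Lemma Pclass_homo : {homo G : x y / x <= y}.
Proof. by case: sG => -[]. Qed.

Lemma Pclass_continuous : continuous G.
Proof. by case: sG => _ []. Qed.

Lemma Pclass_J_interval : is_interval (J G).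
Proof. exact: J_interval Pclass_homo. Qed.

Lemma Pclass_near_J x : J G x -> \forall y \near x, J G y.
Proof. by apply: near_J; exact: Pclass_continuous. Qed.

Lemma Pclass_chord : chord_concave (J G) (phi s \o G).
Proof.
by case: sG => _ /bi_s_concaveP[_ cG _]; exact: concave_on_chord.
Qed.

Lemma Pclass_chord1m : chord_concave (J G) (phi s \o (fun x => 1 - G x)).
Proof.
by case: sG => _ /bi_s_concaveP[_ _ cG]; exact: concave_on_chord.
Qed.

(* Near a point of J(G), the supergradients of phi(G) and phi(1 - G) squeeze G
   between two differentiable functions that touch it there. *)
Lemma Pclass_derivable x : s != 0 -> J G x -> derivable G x 1.
Proof.
move=> s0 Jx; have [u [w [Ju Jw uxw]]] := near_flank (Pclass_near_J Jx).
have [A [a [dA Ax GA]]] := phi_concave_majorant s0 Pclass_J_interval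
  Pclass_chord (fun y Jy => proj1 (andP Jy)) Ju Jw uxw.
have J1m y : J G y -> 0 < 1 - G y by move=> /andP[_]; rewrite subr_gt0.
have [B [b [dB Bx GB]]] := phi_concave_majorant s0 Pclass_J_interval
  Pclass_chord1m J1m Ju Jw uxw.
(* [B] majorizes [1 - G] near [x], so [1 - B] is the lower bound for [G]. *)
have dB1 : is_derive x 1 (cst 1 - B) (0 - b) by exact: is_deriveB.
suff : is_derive x 1 G a by move=> ?; exact: ex_derive.
apply: (squeeze_is_derive Ax _ _ dA dB1).
  by rewrite !fctE Bx opprB addrC subrK.
near=> y; apply/andP; split; last by near: y.
rewrite !fctE lerBlDr -lerBlDl; near: y; exact: GB.
Unshelve. all: by end_near. Qed.

Lemma is_derive_phi_Pclass x : s != 0 -> J G x ->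
  is_derive x 1 (phi s \o G) (G x `^ (s - 1) * derive1 G x).
Proof.
move=> s0 Jx; have dG := Pclass_derivable s0 Jx.
have ? : is_derive x 1 G (derive1 G x).
  by rewrite derive1E; exact: derivableP.
have /andP[G0 _] := Jx.
by apply: is_derive1_comp; exact: is_derive_phi.
Qed.

Lemma is_derive_phi1m_Pclass x : s != 0 -> J G x ->
  is_derive x 1 (phi s \o (fun y => 1 - G y))
    ((1 - G x) `^ (s - 1) * - derive1 G x).
Proof.
move=> s0 Jx; have dG := Pclass_derivable s0 Jx.
have dG' : is_derive x 1 G (derive1 G x).
  by rewrite derive1E; exact: derivableP.
have /andP[_ G1] := Jx.
have d1 : is_derive x 1 (fun y => 1 - G y) (- derive1 G x).
  by have := is_deriveB (is_derive_cst (1 : R) x (1 : R)) dG'; rewrite sub0r.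
have dp : is_derive (1 - G x) 1 (phi s) ((1 - G x) `^ (s - 1)).
  by apply: is_derive_phi; rewrite subr_gt0.
exact: is_derive1_comp.
Qed.

(** Carries convergence of the derivative of [phi s \o G] over to [G']. *)
Lemma derive1_Pclass x : s != 0 -> J G x ->
  derive1 G x = G x `^ (1 - s) * derive1 (phi s \o G) x.
Proof.
move=> s0 Jx; have dG := is_derive_phi_Pclass s0 Jx.
have /andP[G0 _] := Jx.
rewrite [X in _ * X]derive1E derive_val mulrA -powRD; last by rewrite (gt_eqF G0) implybT.
have -> : 1 - s + (s - 1) = 0 by ring. 
by rewrite powRr0 mul1r.
Qed.

End Pclass.

Lemma derive1_powR_phi s (H : R -> R) x : s != 0 ->
  derivable (phi s \o H) x 1 ->
  derive1 (fun y => H y `^ s) x = s * derive1 (phi s \o H) x.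
Proof.
move=> s0 dH; rewrite !derive1E.
have -> : (fun y => H y `^ s) = s \*: (phi s \o H).
  by apply/funext => y; rewrite /= /phi (negbTE s0) /GRing.scale /= mulrCA mulfV ?mulr1.
exact: deriveZ.
Qed.

End BiConcaveClass.

(** * Convergence of derivatives along a filter of concave functions *)

Section JointConvergence.
Context {R : realType} {I : Type}.
Variables (FF : set_system I) (H : I -> R -> R) (K : R -> R) (x0 : R).
Context {FFfilter : Filter FF}.

(** Near [x0], monotonicity traps [H i x] between [H i u] and [H i w] for two fixed points
    [u < x0 < w], where pointwise convergence applies. Convergence jointly in the point and the
    index is what compactness later makes uniform. *)
Lemma cvg_joint_monotone : {for x0, continuous K} ->
  (\forall i \near FF, {homo H i : x y / x <= y}) ->
  (forall y, H i y @[i --> FF] --> K y) ->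
  H p.2 p.1 @[p --> filter_prod (nbhs x0) FF] --> K x0.
Proof.
move=> cK Hle HK; apply/cvgrPdist_le => e e0.
have e2 : 0 < e / 2 by rewrite divr_gt0.
have [u [w [Ku Kw /andP[ux xw]]]] : exists u w,
    [/\ `|K x0 - K u| <= e / 2, `|K x0 - K w| <= e / 2 & u < x0 < w].
  apply: (@near_flank _ (fun y => `|K x0 - K y| <= e / 2)).
  by move/cvgrPdist_le : cK; exact.
have Hu : \forall i \near FF, `|K u - H i u| <= e / 2.
  by have /cvgrPdist_le := HK u; exact.
have Hw : \forall i \near FF, `|K w - H i w| <= e / 2.
  by have /cvgrPdist_le := HK w; exact.
suff : \forall x \near x0 & i \near FF, `|K x0 - H i x| <= e.
  by apply: filterS => -[].
near=> x i.
have ux' : H i u <= H i x.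
  have : {homo H i : x y / x <= y} by near: i.
  by apply; near: x; exact: lt_le_nbhsr.
have xw' : H i x <= H i w.
  have : {homo H i : x y / x <= y} by near: i.
  by apply; near: x; exact: lt_le_nbhsl.
have : `|K u - H i u| <= e / 2 by near: i.
have : `|K w - H i w| <= e / 2 by near: i.
move: Ku Kw; rewrite !ler_norml => /andP[? ?] /andP[? ?] /andP[? ?] /andP[? ?].
by apply/andP; split; lra.
Unshelve. all: by end_near. Qed.

(** First choose [y] so that the chord from [y] to [x0] has slope close to the derivative, then move
    its right end slightly left of [x0], by continuity. The gap between [z] and [x0] makes the chord
    lie to the left of every point close to [x0]. *)
Lemma near_left_chord (Q : set R) (e : R) : derivable K x0 1 -> 0 < e ->
  (\forall y \near x0, Q y) -> exists y z,
  [/\ Q y, Q z, y < z < x0 & chord K y z < derive1 K x0 + e].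
Proof.
move=> dK e0 Qx.
have dK1 : is_derive x0 1 K (derive1 K x0).
  by rewrite derive1E; exact: derivableP.
have shiftx : h + x0 @[h --> (0 : R)] --> x0.
  by rewrite -[X in _ --> X]add0r; apply: cvgD; [exact: cvg_id|exact: cvg_cst].
have [h [h0 hQ hK]] : exists h : R, [/\ h < 0, Q (h + x0) &
    h^-1 * (K (h + x0) - K x0) < derive1 K x0 + e].
  apply: (@filter_ex _ (0^'-)); near=> h; split.
  - near: h; exact: nbhs_left_lt.
  - near: h; apply: cvg_within; exact: shiftx _ Qx.
  - near: h; move/is_derive_slope_cvg/cvg_dnbhs_at_left : dK1 => dK1.
    by apply: (cvgr_lt _ dK1); rewrite ltrDl.
set y := h + x0 in hQ hK *.
have yx : y < x0 by rewrite /y gtrDr.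
have yK : chord K y x0 < derive1 K x0 + e.
  suff -> : chord K y x0 = h^-1 * (K y - K x0) by [].
  rewrite /chord /y; field; rewrite lt_eqF//=.
  by rewrite opprD addrCA subrr addr0 oppr_eq0 lt_eqF.
have cK : {for x0, continuous K}.
  by apply/differentiable_continuous/derivable1_diffP.
have cC : chord K y z @[z --> x0] --> chord K y x0.
  apply: cvgM; first by apply: cvgB; [exact: cK|exact: cvg_cst].
  apply: cvgV; first by rewrite subr_eq0 gt_eqF.
  by apply: cvgB; [exact: cvg_id|exact: cvg_cst].
have [z [Qz yzx zK]] : exists z, [/\ Q z, y < z < x0 &
    chord K y z < derive1 K x0 + e].
  apply: (@filter_ex _ (x0^'-)); near=> z; split.
  - by near: z; apply: cvg_within.
  - apply/andP; split; near: z; last exact: nbhs_left_lt.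
    by apply: cvg_within; exact: lt_nbhsr.
  - by near: z; apply: cvg_within; exact: (cvgr_lt _ cC).
by exists y, z; split.
Unshelve. all: by end_near. Qed.

(** Mirror image of [near_left_chord]. *)
Lemma near_right_chord (Q : set R) (e : R) : derivable K x0 1 -> 0 < e ->
  (\forall y \near x0, Q y) -> exists z y,
  [/\ Q y, Q z, x0 < z < y & derive1 K x0 - e < chord K z y].
Proof.
move=> dK e0 Qx.
have dK1 : is_derive x0 1 K (derive1 K x0).
  by rewrite derive1E; exact: derivableP.
have shiftx : h + x0 @[h --> (0 : R)] --> x0.
  by rewrite -[X in _ --> X]add0r; apply: cvgD; [exact: cvg_id|exact: cvg_cst].
have [h [h0 hQ hK]] : exists h : R, [/\ 0 < h, Q (h + x0) &
    derive1 K x0 - e < h^-1 * (K (h + x0) - K x0)].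
  apply: (@filter_ex _ (0^'+)); near=> h; split.
  - near: h; exact: nbhs_right_gt.
  - near: h; apply: cvg_within; exact: shiftx _ Qx.
  - near: h; move/is_derive_slope_cvg/cvg_dnbhs_at_right : dK1 => dK1.
    by apply: (cvgr_gt _ dK1); rewrite gtrBl.
set y := h + x0 in hQ hK *.
have yx : x0 < y by rewrite /y ltrDr.
have yK : derive1 K x0 - e < chord K x0 y.
  suff -> : chord K x0 y = h^-1 * (K y - K x0) by [].
  by rewrite /chord /y addrK mulrC.
have cK : {for x0, continuous K}.
  by apply/differentiable_continuous/derivable1_diffP.
have cC : chord K z y @[z --> x0] --> chord K x0 y.
  apply: cvgM; first by apply: cvgB; [exact: cvg_cst|exact: cK].
  apply: cvgV; first by rewrite subr_eq0 gt_eqF.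
  by apply: cvgB; [exact: cvg_cst|exact: cvg_id].
have [z [Qz xzy zK]] : exists z, [/\ Q z, x0 < z < y &
    derive1 K x0 - e < chord K z y].
  apply: (@filter_ex _ (x0^'+)); near=> z; split.
  - by near: z; apply: cvg_within.
  - apply/andP; split; near: z; first exact: nbhs_right_gt.
    by apply: cvg_within; exact: lt_nbhsl.
  - by near: z; apply: cvg_within; exact: (cvgr_gt _ cC).
by exists z, y; split.
Unshelve. all: by end_near. Qed.

(* Concavity bounds the derivative of H i at every point close to x0 by the
   slopes of two fixed chords, one on each side of x0, and these converge. *)
Lemma cvg_joint_derive1 (D : I -> set R) :
  (\forall i \near FF, [/\ is_interval (D i), chord_concave (D i) (H i) &
     forall x, D i x -> derivable (H i) x 1]) ->
  (\forall y \near x0, \forall i \near FF, D i y) ->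
  (\forall y \near x0, H i y @[i --> FF] --> K y) ->
  derivable K x0 1 ->
  derive1 (H p.2) p.1 @[p --> filter_prod (nbhs x0) FF] --> derive1 K x0.
Proof.
move=> HD nearD HK dK; apply/cvgrPdist_le => e e0.
(* The points usable as chord ends: eventually in [D i], with convergent values. *)
pose Q y := (\forall i \near FF, D i y) /\ H i y @[i --> FF] --> K y.
have Qx : \forall y \near x0, Q y by exact: filterI nearD HK.
have chordQ u v : Q u -> Q v -> chord (H i) u v @[i --> FF] --> chord K u v.
  by move=> [_ Hu] [_ Hv]; apply: cvgM; [exact: cvgB|exact: cvg_cst].
have [y [z [Qy Qz /andP[yz zx] yzK]]] := near_left_chord dK e0 Qx.
have [v [w [Qw Qv /andP[xv vw] vwK]]] := near_right_chord dK e0 Qx.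
suff : \forall x \near x0 & i \near FF,
    `|derive1 K x0 - derive1 (H i) x| <= e.
  by apply: filterS => -[].
have chordl : \forall i \near FF, chord (H i) y z < derive1 K x0 + e.
  exact: (cvgr_lt _ (chordQ _ _ Qy Qz)).
have chordr : \forall i \near FF, derive1 K x0 - e < chord (H i) v w.
  exact: (cvgr_gt _ (chordQ _ _ Qv Qw)).
have [Dy _] := Qy; have [Dw _] := Qw.
near=> x i.
have [iD cH dH] : [/\ is_interval (D i), chord_concave (D i) (H i) &
    forall x, D i x -> derivable (H i) x 1] by near: i.
have Diy : D i y by near: i.
have Diw : D i w by near: i.
have zx' : z <= x by near: x; exact: lt_le_nbhsr.
have xv' : x <= v by near: x; exact: lt_le_nbhsl.
have yx : y < x by exact: lt_le_trans zx'.
have xw : x < w by exact: le_lt_trans vw.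
have Dx : D i x by apply: (iD y w) => //; rewrite !ltW.
have dHx : is_derive x 1 (H i) (derive1 (H i) x).
  by rewrite derive1E; apply: derivableP; exact: dH.
have dl := derive_le_chord iD cH Diy Diw yz zx' xw dHx.
have dr := chord_le_derive iD cH Diy Diw yx xv' vw dHx.
have cl : chord (H i) y z < derive1 K x0 + e by near: i.
have cr : derive1 K x0 - e < chord (H i) v w by near: i.
by rewrite ler_norml; apply/andP; split; lra.
Unshelve. all: by end_near. Qed.

End JointConvergence.

(** * Pointwise neighbourhoods of F *)

Section PointwiseFilter.
Context {R : realType}.
Implicit Types (F G : R -> R) (s x : R).

(** The neighbourhood filter of [F] for pointwise convergence. The explicit finite list of points
    lets consistency be applied at each of them. *)
Definition pointwise_near F : set_system (R -> R) :=
  [set Q | exists (xs : seq R) (e : R), 0 < e /\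
     forall G, (forall x, x \in xs -> `|G x - F x| < e) -> Q G].

Global Instance pointwise_near_filter F : Filter (pointwise_near F).
Proof.
split.
- by exists [::], 1.
- move=> A B [xs [a [a0 xsA]]] [ys [b [b0 ysB]]].
  exists (xs ++ ys), (Num.min a b); split; first by rewrite lt_min a0 b0.
  move=> G Gxy; split; [apply: xsA|apply: ysB] => x xin.
    by have := Gxy x; rewrite mem_cat xin lt_min => /(_ isT)/andP[].
  by have := Gxy x; rewrite mem_cat xin orbT lt_min => /(_ isT)/andP[].
- move=> A B AB [xs [a [a0 xsA]]]; exists xs, a; split => // G /xsA; exact: AB.
Qed.

(** This trace on the class is an improper filter exactly when [F] is not a pointwise limit of
    members of the class; [near_not_Pclass] uses this. *)
Definition Pclass_near s F := within (Pclass s) (pointwise_near F).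

Lemma cvg_Pclass_near s F x : G x @[G --> Pclass_near s F] --> F x.
Proof.
apply/cvgrPdist_lt => e e0; exists [:: x], e; split => // G Gx _.
by rewrite distrC Gx// mem_head.
Qed.

Lemma near_Pclass s F : \forall G \near Pclass_near s F, Pclass s G.
Proof. by exists [::], 1. Qed.

Lemma Pclass_near_self s F (Q : set (R -> R)) : Pclass s F ->
  (\forall G \near Pclass_near s F, Q G) -> Q F.
Proof.
move=> sF [xs [e [e0 xsQ]]]; apply: xsQ => // x _.
by rewrite subrr normr0.
Qed.

Section Consistency.
Variables (s : R) (F : R -> R).
Hypothesis F_continuous : continuous F.

Lemma near_Pclass_J x : J F x -> \forall G \near Pclass_near s F, J G x.
Proof.
move=> /andP[Fx0 Fx1]; have cF := @cvg_Pclass_near s F x.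
have G0 : \forall G \near Pclass_near s F, 0 < G x by exact: (cvgr_gt _ cF).
have G1 : \forall G \near Pclass_near s F, G x < 1 by exact: (cvgr_lt _ cF).
by apply: filterS2 G0 G1 => G G0 G1; apply/andP.
Qed.

Lemma near_Pclass_J_itv a b : a <= b -> `[a, b] `<=` J F ->
  \forall G \near Pclass_near s F, `[a, b] `<=` J G.
Proof.
move=> ab abJ; near=> G => x /=; rewrite in_itv /=.
have sG : Pclass s G by near: G; exact: near_Pclass.
apply: (Pclass_J_interval sG); near: G; apply: near_Pclass_J; apply: abJ;
  by rewrite /= in_itv/= lexx ab.
Unshelve. all: by end_near. Qed.

Lemma cvg_joint_Pclass x :
  p.2 p.1 @[p --> filter_prod (nbhs x) (Pclass_near s F)] --> F x.
Proof.
apply: (cvg_joint_monotone (H := id)); first exact: F_continuous.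
  by apply: filterS (near_Pclass s F) => G; exact: Pclass_homo.
by move=> y; exact: cvg_Pclass_near.
Qed.

Lemma near_joint_J x : J F x ->
  \forall y \near x & G \near Pclass_near s F, Pclass s G /\ J G y.
Proof.
move=> /andP[Fx0 Fx1].
have c := cvg_joint_Pclass (x := x).
suff : \forall p \near filter_prod (nbhs x) (Pclass_near s F),
   Pclass s p.2 /\ J p.2 p.1 by [].
near=> p; split.
  by near: p; apply: cvg_snd; exact: near_Pclass.
apply/andP; split; near: p; first exact: (cvgr_gt _ c).
exact: (cvgr_lt _ c).
Unshelve. all: by end_near. Qed.

(** On a segment, compactness and joint convergence give uniformity. Beyond its ends, monotonicity
    keeps both functions within [e / 2] of 0 or of 1. *)
Lemma near_Pclass_uniform (e : R) : distribution_function F -> 0 < e ->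
  \forall G \near Pclass_near s F, forall x, `|G x - F x| <= e.
Proof.
move=> dF e0; have [Fle _ FN FY] := dF.
have e2 : 0 < e / 2 by rewrite divr_gt0.
have [a Fa] : exists a, F a < e / 2.
  by apply: (@filter_ex _ (@ninfty_nbhs R)); exact: (cvgr_lt _ FN).
have [b Fb] : exists b, 1 - e / 2 < F b.
  by apply: (@filter_ex _ (@pinfty_nbhs R)); apply: (cvgr_gt _ FY); rewrite gtrBl.
have Ga : \forall G \near Pclass_near s F, G a < e / 2.
  exact: (cvgr_lt _ (@cvg_Pclass_near s F a)).
have Gb : \forall G \near Pclass_near s F, 1 - e / 2 < G b.
  exact: (cvgr_gt _ (@cvg_Pclass_near s F b)).
have Gab : \forall G \near Pclass_near s F,
    `[a, b] `<=` (fun x => `|G x - F x| <= e).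
  (* Compactness as a near-covering property: a statement that holds jointly near each point of the
     segment and near [F] holds near [F] on the whole segment. *)
  apply: (proj1 (compact_near_coveringP _) (@segment_compact R a b) _ _
    (fun G x => `|G x - F x| <= e)) => x _.
  have /cvgrPdist_le/(_ _ e2) Gx := cvg_joint_Pclass (x := x).
  have Fx : \forall y \near x, `|F x - F y| <= e / 2.
    by have /cvgrPdist_le := F_continuous (x := x); exact.
  suff : \forall p \near filter_prod (nbhs x) (Pclass_near s F),
    `|p.2 p.1 - F p.1| <= e by [].
  near=> p.
  have : `|F x - p.2 p.1| <= e / 2 by near: p.
  have : `|F x - F p.1| <= e / 2 by near: p; exact: cvg_fst Fx.
  rewrite !ler_norml => /andP[? ?] /andP[? ?].
  by apply/andP; split; lra.
near=> G => x.
have [dG _] : Pclass s G by near: G; exact: near_Pclass.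
have Gle : {homo G : x y / x <= y} by case: dG.
have Fx0 := distribution_function_ge0 x dF.
have Fx1 := distribution_function_le1 x dF.
have Gx0 := distribution_function_ge0 x dG.
have Gx1 := distribution_function_le1 x dG.
have [xa|ax] := leP x a.
  have : G a < e / 2 by near: G.
  have := Fle _ _ xa; have := Gle _ _ xa => ? ? ?.
  by rewrite ler_norml; apply/andP; split; lra.
have [bx|xb] := leP b x.
  have : 1 - e / 2 < G b by near: G.
  have := Fle _ _ bx; have := Gle _ _ bx => ? ? ?.
  by rewrite ler_norml; apply/andP; split; lra.
suff : `[a, b] `<=` (fun x => `|G x - F x| <= e).
  by apply; rewrite /= in_itv /= !ltW.
by near: G.
Unshelve. all: by end_near. Qed.

Hypothesis (sF : Pclass s F) (s0 : s != 0).

Lemma cvg_joint_phi x : J F x ->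
  (fun p : R * (R -> R) => derive1 (phi s \o p.2) p.1)
    @ filter_prod (nbhs x) (Pclass_near s F) --> derive1 (phi s \o F) x.
Proof.
move=> Jx; apply: (cvg_joint_derive1 (H := fun G => phi s \o G) (D := J)).
- near=> G; have sG : Pclass s G by near: G; exact: near_Pclass.
  split; [exact: Pclass_J_interval sG|exact: Pclass_chord sG|].
  by move=> y /(is_derive_phi_Pclass sG s0) dG; exact: ex_derive.
- by apply: filterS (Pclass_near_J sF Jx) => y; exact: near_Pclass_J.
- apply: filterS (Pclass_near_J sF Jx) => y /andP[Fy _].
  by apply: continuous_cvg; [exact: phi_continuous|exact: cvg_Pclass_near].
- by have dF := is_derive_phi_Pclass sF s0 Jx; exact: ex_derive.
Unshelve. all: by end_near. Qed.

Lemma cvg_joint_phi1m x : J F x ->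
  (fun p : R * (R -> R) => derive1 (phi s \o (fun y => 1 - p.2 y)) p.1)
    @ filter_prod (nbhs x) (Pclass_near s F)
  --> derive1 (phi s \o (fun y => 1 - F y)) x.
Proof.
move=> Jx.
apply: (cvg_joint_derive1 (H := fun G => phi s \o (fun y => 1 - G y)) (D := J)).
- near=> G; have sG : Pclass s G by near: G; exact: near_Pclass.
  split; [exact: Pclass_J_interval sG|exact: Pclass_chord1m sG|].
  by move=> y /(is_derive_phi1m_Pclass sG s0) dG; exact: ex_derive.
- by apply: filterS (Pclass_near_J sF Jx) => y; exact: near_Pclass_J.
- apply: filterS (Pclass_near_J sF Jx) => y /andP[_ Fy].
  apply: continuous_cvg; first by apply: phi_continuous; rewrite subr_gt0.
  by apply: cvgB; [exact: cvg_cst|exact: cvg_Pclass_near].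
- by have dF := is_derive_phi1m_Pclass sF s0 Jx; exact: ex_derive.
Unshelve. all: by end_near. Qed.

(** On [J G] each map is the derivative of [phi(G)] or [phi(1 - G)] times [s] or a power of [G].
    These identities hold only on [J G], and [near_joint_J] makes them available near [(x, F)]. *)
Lemma cvg_joint_h_maps h x : h_maps s h -> J F x ->
  h p.2 p.1 @[p --> filter_prod (nbhs x) (Pclass_near s F)] --> h F x.
Proof.
move=> hh Jx; have /andP[Fx0 Fx1] := Jx.
case: hh => [[->|->]|->].
- rewrite (derive1_Pclass sF s0 Jx).
  have cpow : {for F x, continuous (fun t => t `^ (1 - s))}.
    have dp := is_derive1_powR (1 - s) Fx0.
    by apply/differentiable_continuous/derivable1_diffP; exact: ex_derive.
  have cGpow := cvg_comp _ _ (cvg_joint_Pclass (x := x)) cpow.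
  apply: cvg_trans; last exact: cvgM cGpow (cvg_joint_phi Jx).
  apply: near_eq_cvg; apply: filterS (near_joint_J Jx) => -[y G] /= [sG JG].
  by rewrite (derive1_Pclass sG).
- rewrite derive1_powR_phi//; last first.
    by have dF := is_derive_phi_Pclass sF s0 Jx; exact: ex_derive.
  apply: cvg_trans; last exact: cvgM (cvg_cst s) (cvg_joint_phi Jx).
  apply: near_eq_cvg; apply: filterS (near_joint_J Jx) => -[y G] /= [sG JG].
  have dG := is_derive_phi_Pclass sG s0 JG.
  by rewrite derive1_powR_phi//; exact: ex_derive.
- rewrite (derive1_powR_phi (H := fun y => 1 - F y))//; last first.
    by have dF := is_derive_phi1m_Pclass sF s0 Jx; exact: ex_derive.
  apply: cvg_trans; last exact: cvgM (cvg_cst s) (cvg_joint_phi1m Jx).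
  apply: near_eq_cvg; apply: filterS (near_joint_J Jx) => -[y G] /= [sG JG].
  have dG := is_derive_phi1m_Pclass sG s0 JG.
  by rewrite (derive1_powR_phi (H := fun y => 1 - G y))//; exact: ex_derive.
Qed.

Lemma near_h_maps_uniform h a b (e : R) : h_maps s h -> `[a, b] `<=` J F ->
  0 < e ->
  \forall G \near Pclass_near s F, forall x, x \in `[a, b] ->
    `|h G x - h F x| <= e.
Proof.
move=> hh abJ e0; have e2 : 0 < e / 2 by rewrite divr_gt0.
apply: (proj1 (compact_near_coveringP _) (@segment_compact R a b) _ _
  (fun G x => `|h G x - h F x| <= e)) => x xab.
have /cvgrPdist_le/(_ _ e2) hx := cvg_joint_h_maps hh (abJ _ xab).
(* Taking [G = F] in the joint convergence gives continuity of [h F] at [x]. *)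
have hF : \forall y \near x, `|h F x - h F y| <= e / 2.
  case: hx => -[A B] /= [nA nB] AB; apply: filterS nA => y Ay.
  by apply: (AB (y, F)); split => //=; exact: Pclass_near_self nB.
suff : \forall p \near filter_prod (nbhs x) (Pclass_near s F),
  `|h p.2 p.1 - h F p.1| <= e by [].
near=> p.
have : `|h F x - h p.2 p.1| <= e / 2 by near: p.
have : `|h F x - h F p.1| <= e / 2 by near: p; exact: cvg_fst hF.
rewrite !ler_norml => /andP[? ?] /andP[? ?].
by apply/andP; split; lra.
Unshelve. all: by end_near. Qed.

End Consistency.

End PointwiseFilter.

(** * The refined band *)

Section RefinedBand.
Context {R : realType}.
Implicit Types (F G : R -> R) (L U : R -> R) (s x : R).

(** A strict failure of the concavity inequality for [K] would persist for [H i] eventually. The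
    domains vary with [i], but only the two end points need to lie in [D i]. *)
Lemma concave_on_lim (I : Type) (FF : set_system I) (H : I -> R -> R)
    (D : I -> set R) (K : R -> R) (E : set R) : ProperFilter FF ->
  is_interval E -> (forall y, E y -> H i y @[i --> FF] --> K y) ->
  (forall y, E y -> \forall i \near FF, D i y) ->
  (\forall i \near FF, concave_on (D i) (H i)) -> concave_on E K.
Proof.
move=> FFP iE HK ED cH; apply/concave_onP => t x y t01 Ex Ey.
have Exy : E (t * x + (1 - t) * y).
  have /andP[t0 t1] := t01.
  have [xy|yx] := leP x y; [apply: (iE x y)|apply: (iE y x)] => //;
    by apply/andP; split; nra.
have cl : t * H i x + (1 - t) * H i y @[i --> FF] --> t * K x + (1 - t) * K y.
  by apply: cvgD; apply: cvgM; [exact: cvg_cst|exact: HK|exact: cvg_cst|exact: HK].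
rewrite leNgt -subr_lt0; apply/negP => lt0.
have cd : H i (t * x + (1 - t) * y) - (t * H i x + (1 - t) * H i y)
    @[i --> FF] --> K (t * x + (1 - t) * y) - (t * K x + (1 - t) * K y).
  by apply: cvgB; [exact: HK|exact: cl].
have gap : \forall i \near FF,
    H i (t * x + (1 - t) * y) - (t * H i x + (1 - t) * H i y) < 0.
  exact: (cvgr_lt _ cd).
have : \forall i \near FF, False.
  near=> i.
  have : H i (t * x + (1 - t) * y) - (t * H i x + (1 - t) * H i y) < 0.
    by near: i.
  apply/negP; rewrite -leNgt subr_ge0.
  have /concave_onP : concave_on (D i) (H i) by near: i.
  by apply => //; near: i; exact: ED.
exact: filter_not_empty.
Unshelve. all: by end_near. Qed.

(** If the filter were proper, [F] would be a limit of members of the class and would inherit the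
    concavity of [phi(G)] and [phi(1 - G)]. *)
Lemma near_not_Pclass s F : distribution_function F -> continuous F ->
  ~ Pclass s F -> \forall G \near Pclass_near s F, False.
Proof.
move=> dF cF nsF; apply: contrapT => ne.
have FFP : ProperFilter (Pclass_near s F).
  by split; [exact: ne|exact: _].
have [Fle _ _ _] := dF; have iJ := J_interval Fle.
apply: nsF; split => //.
apply/bi_s_concaveP; split => //.
- apply: (concave_on_lim FFP (D := J) (H := fun G => phi s \o G)) => //.
  + move=> y /andP[Fy _].
    by apply: continuous_cvg; [exact: phi_continuous|exact: cvg_Pclass_near].
  + exact: near_Pclass_J.
  + by apply: filterS (near_Pclass s F) => G [_ /bi_s_concaveP[]].
- apply: (concave_on_lim FFP (D := J) (H := fun G x => phi s (1 - G x))) => //.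
  + move=> y /andP[_ Fy].
    have c1 : 1 - G y @[G --> Pclass_near s F] --> 1 - F y.
      by apply: cvgB; [exact: cvg_cst|exact: cvg_Pclass_near].
    have c2 : {for 1 - F y, continuous (phi s)}.
      by apply: phi_continuous; rewrite subr_gt0.
    exact: cvg_comp _ _ c1 c2.
  + exact: near_Pclass_J.
  + by apply: filterS (near_Pclass s F) => G [_ /bi_s_concaveP[]].
Qed.

Lemma has_ubound_band s L U x : has_ubound [set G x | G in in_band s L U].
Proof.
by exists 1 => _ [G [[dG _] _] <-]; exact: distribution_function_le1.
Qed.

Lemma has_lbound_band s L U x : has_lbound [set G x | G in in_band s L U].
Proof.
by exists 0 => _ [G [[dG _] _] <-]; exact: distribution_function_ge0.
Qed.

Lemma refined_leP s L U :
  (forall x, refined_lower s L U x <= refined_upper s L U x) <->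
  in_band s L U !=set0.
Proof.
split=> [|ne x].
  (* With no function in the band the inequality reads [1 <= 0]. *)
  rewrite /refined_lower /refined_upper; case: asboolP => // _ /(_ 0).
  by rewrite ler10.
rewrite /refined_lower /refined_upper asboolT//; have [G bG] := ne.
apply: (@le_trans _ _ (G x)).
  by apply: ge_inf; [exact: has_lbound_band|exists G].
by apply: ub_le_sup; [exact: has_ubound_band|exists G].
Qed.

(** The condition [0 <= c] covers the default value 0 taken when the band contains no member of the
    class. *)
Lemma refined_upper_le s L U x c : 0 <= c ->
  (forall G, in_band s L U G -> G x <= c) -> refined_upper s L U x <= c.
Proof.
move=> c0 Gc; rewrite /refined_upper; case: asboolP => // -[G bG].
by apply: ge_sup; [exists (G x), G|move=> _ [H bH <-]; exact: Gc].
Qed.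

Lemma refined_lower_ge s L U x c : 0 <= c ->
  (forall G, in_band s L U G -> 1 - G x <= c) ->
  1 - refined_lower s L U x <= c.
Proof.
move=> c0 Gc; rewrite /refined_lower; case: asboolP => [[G bG]|_].
  rewrite lerBlDr -lerBlDl; apply: lb_le_inf; first by exists (G x), G.
  by move=> _ [H bH <-]; rewrite lerBlDl -lerBlDr; exact: Gc.
by rewrite subrr.
Qed.

(* phi(G) is concave, hence steeper to the left of x1 than at x1. *)
Lemma Pclass_le_chord s G (V : R -> R) (b x1 x y : R) : s != 0 ->
  Pclass s G -> J G x1 -> 0 < b -> b < derive1 (phi s \o G) x1 ->
  x <= y -> y <= x1 -> G y <= V y ->
  G x <= Num.max (V y `^ s + s * b * (x - y)) 0 `^ s^-1.
Proof.
move=> s0 sG Jx1 b0 bd xy yx1 GV.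
have dG : distribution_function G by case: sG.
have Gle := Pclass_homo sG.
have := distribution_function_ge0 x dG.
(* If [G x = 0] the bound is trivial, a power being nonnegative; otherwise [x] lies in [J G]. *)
rewrite le_eqVlt => /predU1P[<-|Gx0]; first exact: powR_ge0.
have Gy0 : 0 < G y by rewrite (lt_le_trans Gx0)// Gle.
have Jx : J G x.
  by apply/andP; split => //; case/andP: Jx1 => _; apply: le_lt_trans; rewrite Gle// (le_trans xy).
rewrite -mulrA; apply: (le_phi_inv_max s0 Gx0 Gy0 GV).
  by move=> _; rewrite mulr_ge0_le0 ?(ltW b0)// subr_le0.
have [u [w [Ju Jw /andP[ux1 x1w]]]] := near_flank (Pclass_near_J sG Jx1).
move: xy; rewrite le_eqVlt => /predU1P[<-|xy].
  by rewrite subrr mulr0 addr0.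
have dphi : is_derive x1 1 (phi s \o G) (derive1 (phi s \o G) x1).
  rewrite derive1E; apply: derivableP.
  by have ? := is_derive_phi_Pclass sG s0 Jx1; exact: ex_derive.
have := derive_le_chord (Pclass_J_interval sG) (Pclass_chord sG) Jx Jw xy yx1 x1w dphi.
move=> /(lt_le_trans bd)/ltW.
by rewrite /chord ler_pdivlMr ?subr_gt0//= => ?; nra.
Qed.

(** By concavity, the chord of [phi(1 - G)] from [y] to [x] has slope at most the derivative at
    [x2], hence below [- b]. *)
Lemma Pclass_ge_chord s G (V : R -> R) (b x2 x y : R) : s != 0 ->
  Pclass s G -> J G x2 -> 0 < b ->
  derive1 (phi s \o (fun z => 1 - G z)) x2 < - b ->
  x2 <= y -> y <= x -> V y <= G y ->
  1 - G x <= Num.max ((1 - V y) `^ s - s * b * (x - y)) 0 `^ s^-1.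
Proof.
move=> s0 sG Jx2 b0 bd x2y yx VG.
have dG : distribution_function G by case: sG.
have Gle := Pclass_homo sG.
have := distribution_function_le1 x dG.
rewrite le_eqVlt => /predU1P[->|Gx1]; first by rewrite subrr powR_ge0.
have Gx1' : 0 < 1 - G x by rewrite subr_gt0.
have Gy1' : 0 < 1 - G y by rewrite subr_gt0 (le_lt_trans _ Gx1)// Gle.
have Jx : J G x.
  by apply/andP; split => //; case/andP: Jx2 => + _ => /lt_le_trans; apply; rewrite Gle// (le_trans x2y).
have VG' : 1 - G y <= 1 - V y by rewrite lerD2l lerN2.
have -> : - (s * b * (x - y)) = s * (- b * (x - y)) by ring.
apply: (le_phi_inv_max s0 Gx1' Gy1' VG').
  by move=> _; rewrite mulNr oppr_le0 mulr_ge0 ?(ltW b0)// subr_ge0.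
have [u [w [Ju Jw /andP[ux2 x2w]]]] := near_flank (Pclass_near_J sG Jx2).
move: yx; rewrite le_eqVlt => /predU1P[->|yx].
  by rewrite subrr mulr0 addr0.
have dphi : is_derive x2 1 (phi s \o (fun z => 1 - G z))
    (derive1 (phi s \o (fun z => 1 - G z)) x2).
  rewrite derive1E; apply: derivableP.
  by have ? := is_derive_phi1m_Pclass sG s0 Jx2; exact: ex_derive.
have := chord_le_derive (Pclass_J_interval sG) (Pclass_chord1m sG) Ju Jx ux2 x2y yx dphi.
move=> /le_lt_trans/(_ bd)/ltW.
by rewrite /chord ler_pdivrMr ?subr_gt0//= => ?; nra.
Qed.

Lemma esup0_supnorm_le (K : set R) (S : set (R -> R))
    (D : (R -> R) -> R -> R) (e : R) : K !=set0 -> 0 <= e ->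
  (forall G x, S G -> K x -> `|D G x| <= e) ->
  (`|esup0 [set supnorm K (D G) | G in S] - 0%:E| <= e%:E)%E.
Proof.
move=> [k Kk] e0 De; rewrite sube0 /esup0; case: asboolP => [[_ [G SG _]]|_].
  rewrite gee0_abs.
    apply: ge_ereal_sup => _ [H SH <-]; apply: ge_ereal_sup => _ [x Kx <-].
    by rewrite lee_fin; exact: De.
  (* The point [k] of [K] shows that the supremum is nonnegative, so it equals its absolute
     value. *)
  apply: (@le_trans _ _ (supnorm K (D G))).
    apply: (@le_trans _ _ `|D G k|%:E); first by rewrite lee_fin.
    by apply: ereal_sup_ubound; exists k.
  by apply: ereal_sup_ubound; exists G.
by rewrite abse0 lee_fin.
Qed.

End RefinedBand.

(** * Outer probabilities *)

Section Asymptotics.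
Context {d : measure_display} {T : measurableType d} {R : realType}.
Variable P : probability T R.
Local Open Scope ereal_scope.

Lemma near_rat_flank (x : R) (Q : set R) : (\forall z \near x, Q z) ->
  exists p q : rat, [/\ (ratr p < x < ratr q)%R, Q (ratr p) & Q (ratr q)].
Proof.
move=> /nbhs_ballP[e /= e0 xQ].
have xe : (x - e < x)%R by rewrite gtrBl.
have ex : (x < x + e)%R by rewrite ltrDl.
have [p] := rat_in_itvoo xe; rewrite in_itv /= => /andP[xep px].
have [q] := rat_in_itvoo ex; rewrite in_itv /= => /andP[xq qxe].
exists p, q; split; first by rewrite px xq.
- by apply: xQ; rewrite /ball /= ltr_norml; apply/andP; split; lra.
- by apply: xQ; rewrite /ball /= ltr_norml; apply/andP; split; lra.
Qed.

Lemma mu_ext_cvg0S (A B : nat -> set T) : (forall n, A n `<=` B n) ->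
  mu_ext P (B n) @[n --> \oo] --> 0 -> mu_ext P (A n) @[n --> \oo] --> 0.
Proof.
move=> AB; apply: squeeze_cvge; last exact: cvg_cst.
by apply: nearW => n; rewrite mu_ext_ge0//= le_mu_ext.
Qed.

Lemma mu_ext_cvg0U (A B : nat -> set T) :
  mu_ext P (A n) @[n --> \oo] --> 0 -> mu_ext P (B n) @[n --> \oo] --> 0 ->
  mu_ext P (A n `|` B n) @[n --> \oo] --> 0.
Proof.
move=> A0 B0; have AB0 : mu_ext P (A n) + mu_ext P (B n) @[n --> \oo] --> 0 + 0.
  exact: cvgeD.
rewrite adde0 in AB0; apply: squeeze_cvge AB0; last exact: cvg_cst.
by apply: nearW => n; rewrite mu_ext_ge0//= outer_measureU2.
Qed.

Lemma mu_ext_cvg0_seq (I : eqType) (xs : seq I) (B : I -> nat -> set T) :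
  (forall i, mu_ext P (B i n) @[n --> \oo] --> 0) ->
  mu_ext P [set w | exists2 i, i \in xs & B i n w] @[n --> \oo] --> 0.
Proof.
move=> B0; elim: xs => [|x xs IH].
  rewrite (_ : (fun n => _) = cst 0); first exact: cvg_cst.
  apply/funext => n; rewrite (_ : [set w | _] = set0) ?outer_measure0//.
  by apply/seteqP; split => // w [].
apply: mu_ext_cvg0S (mu_ext_cvg0U (B0 x) IH) => n w [i].
by rewrite inE => /predU1P[->|xi] Biw; [left|right; exists i].
Qed.

Lemma inner_prob_cvg1 (A : nat -> set T) :
  mu_ext P (~` A n) @[n --> \oo] --> 0 -> inner_prob P (A n) @[n --> \oo] --> 1.
Proof.
move=> A0; rewrite /inner_prob -[X in _ --> X]sube0.
by apply: cvgeB => //; exact: cvg_cst.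
Qed.

(** * Functions in a consistent band *)

Section Band.
Variables (s : R) (F : R -> R) (L U : nat -> T -> R -> R).
Hypothesis consistent : forall x : R,
  cvg_in_prob P (fun n w => (L n w x)%:E) (F x) /\
  cvg_in_prob P (fun n w => (U n w x)%:E) (F x).

(** The neighbourhood is given by finitely many points and a radius [e]. If [L] and [U] are both
    within [e / 2] of [F] at those points, every [G] between them lies in the neighbourhood;
    consistency makes the exceptional event negligible. *)
Lemma mu_ext_band_cvg0 (Q : set (R -> R)) :
  (\forall G \near Pclass_near s F, Q G) ->
  mu_ext P [set w | exists2 G, in_band s (L n w) (U n w) G & ~ Q G]
    @[n --> \oo] --> 0.
Proof.
move=> [xs [e [e0 xsQ]]]; have e2 : (0 < e / 2)%R by rewrite divr_gt0.
pose B (x : R) n :=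
  [set w | (e / 2)%:E < `|(L n w x)%:E - (F x)%:E|] `|`
  [set w | (e / 2)%:E < `|(U n w x)%:E - (F x)%:E|].
have B0 x : mu_ext P (B x n) @[n --> \oo] --> 0.
  by have [cL cU] := consistent x; apply: mu_ext_cvg0U; [exact: cL|exact: cU].
apply: mu_ext_cvg0S (mu_ext_cvg0_seq xs B0) => n w [G [sG LGU] nQ].
apply: contrapT => nB; apply: nQ; apply: xsQ => // x xin.
have : ~ B x n w by move=> Bx; apply: nB; exists x.
rewrite /B /= !lte_fin => /not_orP[/negP + /negP].
rewrite -!leNgt !ler_norml ltr_norml => /andP[? ?] /andP[? ?].
by have /andP[? ?] := LGU x; apply/andP; split; lra.
Qed.

Lemma inner_prob_band_cvg1 (Q : set (R -> R)) (A : nat -> set T) :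
  (\forall G \near Pclass_near s F, Q G) ->
  (forall n w, (forall G, in_band s (L n w) (U n w) G -> Q G) -> A n w) ->
  inner_prob P (A n) @[n --> \oo] --> 1.
Proof.
move=> nearQ QA; apply: inner_prob_cvg1.
apply: mu_ext_cvg0S (mu_ext_band_cvg0 nearQ) => n w nA.
apply: contrapT => ne; apply: nA; apply: QA => G bG.
by apply: contrapT => nQ; apply: ne; exists G.
Qed.

Lemma esup0_band_cvg0 (K : set R) (D : (R -> R) -> R -> R) : K !=set0 ->
  (forall e, (0 < e)%R -> \forall G \near Pclass_near s F,
     forall x, K x -> (`|D G x| <= e)%R) ->
  cvg_in_prob P (fun n w =>
    esup0 [set supnorm K (D G) | G in in_band s (L n w) (U n w)]) 0.
Proof.
move=> K0 De e e0; apply: mu_ext_cvg0S (mu_ext_band_cvg0 (De e e0)) => n w /=.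
apply: contraPP => ne; apply/negP; rewrite -leNgt.
apply: esup0_supnorm_le; rewrite ?ltW// => G x bG Kx.
by apply: contrapT => nle; apply: ne; exists G => // /(_ x Kx).
Qed.

End Band.

(** * Distribution function and coverage event of the sample *)

Lemma cdf_distribution_function (X : {RV P >-> R}) (F : R -> R) :
  (forall x, cdf X x = (F x)%:E) -> distribution_function F.
Proof.
move=> XF; have E : cdf X = EFin \o F by apply/funext => x; rewrite XF.
split.
- by move=> x y xy; rewrite -lee_fin -!XF; exact: cdf_nondecreasing.
- move=> x; have := @cdf_right_continuous _ _ _ P X x; rewrite E.
  by move/fine_cvg.
- by have := @cvg_cdfNy0 _ _ _ P X; rewrite E => /fine_cvg.
- by have := @cvg_cdfy1 _ _ _ P X; rewrite E => /fine_cvg.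
Qed.

Lemma measurable_sample (X : nat -> {RV P >-> R}) n :
  measurable_fun [set: T] (sample X n).
Proof.
apply/measurable_fun_tnthP => i.
have -> : (@tnth n R)^~ i \o sample X n = X i.
  by apply/funext => w; rewrite /= /sample tnth_mktuple.
exact: measurable_funPT.
Qed.

(* By continuity of F and monotonicity of L and U, rational points decide
   whether F stays inside the band. *)
Lemma measurable_coverage (X : nat -> {RV P >-> R}) (F : R -> R) alpha n
    (L U : n.-tuple R -> R -> R) : continuous F ->
  confidence_band X F alpha L U ->
  measurable [set w | forall x,
    (L (sample X n w) x <= F x <= U (sample X n w) x)%R].
Proof.
move=> cF [mono meas _ _].
set A := (X in measurable X).
pose B (q : rat) :=
  [set w | (F (ratr q) < L (sample X n w) (ratr q))%R] `|`
  [set w | (U (sample X n w) (ratr q) < F (ratr q))%R].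
have -> : A = ~` (\bigcup_q B q).
  apply/seteqP; split => [w Aw [q _] [/=|/=]|w nB x].
  - by have /andP[+ _] := Aw (ratr q); rewrite ltNge => ->.
  - by have /andP[_ +] := Aw (ratr q); rewrite ltNge => ->.
  have [Lle Ule] := mono (sample X n w).
  apply/andP; split; rewrite leNgt; apply/negP => Fx.
  (* If [F x < L x], the violation persists at rationals just right of [x], as [L] is
     non-decreasing; for [U] the rationals lie to the left. *)
  - have : \forall z \near x, (F z < L (sample X n w) x)%R.
      exact: (cvgr_lt _ (cF x)).
    move=> /near_rat_flank[_ [q [/andP[_ xq] _ Fq]]].
    by apply: nB; exists q => //; left; rewrite /= (lt_le_trans Fq)// Lle// ltW.
  - have : \forall z \near x, (U (sample X n w) x < F z)%R.
      exact: (cvgr_gt _ (cF x)).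
    move=> /near_rat_flank[q [_ [/andP[qx _] Fq _]]].
    by apply: nB; exists q => //; right; rewrite /= (le_lt_trans _ Fq)// Ule// ltW.
apply: measurableC; apply: bigcupT_measurable_rat => q.
have mS := @measurable_sample X n; have [mL mU] := meas (ratr q).
apply: measurableU.
- rewrite -[X in measurable X]setTI.
  rewrite (_ : [set w | _] =
    (L ^~ (ratr q) \o sample X n) @^-1` `]F (ratr q), +oo[); last first.
    by apply/seteqP; split => w; rewrite /= in_itv /= andbT.
  by apply: (measurableT_comp mL mS) => //; exact: measurable_itv.
- rewrite -[X in measurable X]setTI.
  rewrite (_ : [set w | _] =
    (U ^~ (ratr q) \o sample X n) @^-1` `]-oo, F (ratr q)[); last first.
    by apply/seteqP; split => w; rewrite /= in_itv /=.
  by apply: (measurableT_comp mU mS) => //; exact: measurable_itv.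
Qed.

End Asymptotics.

(** * Limit behaviour of the refined band *)

Theorem theorem7 (R : realType) (d : measure_display) (T : measurableType d)
    (P : probability T R) (s alpha : R) (X : nat -> {RV P >-> R}) (F : R -> R)
    (L U : forall n : nat, n.-tuple R -> R -> R)
    (Ln := fun n w => L n (sample X n w))
    (Un := fun n w => U n (sample X n w))
    (Lo := fun n w => refined_lower s (Ln n w) (Un n w))
    (Uo := fun n w => refined_upper s (Ln n w) (Un n w))
    (s_le1 : s <= 1) (alpha01 : 0 < alpha < 1)
    (F_continuous : continuous F) (X_iid : iid_with_cdf X F)
    (* for n = 0 there are no data, and no band has coverage 1 - alpha *)
    (band : forall n, (0 < n)%N -> confidence_band X F alpha (L n) (U n))
    (consistent : forall x : R,
       cvg_in_prob P (fun n w => (Ln n w x)%:E) (F x) /\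
       cvg_in_prob P (fun n w => (Un n w x)%:E) (F x)) :
  (~ Pclass s F ->
     mu_ext P [set w | forall x, (Lo n w x <= Uo n w x)%R] @[n --> \oo] --> 0%E)
  /\
  (Pclass s F -> s != 0 ->
     [/\ forall n, (0 < n)%N ->
           ((1 - alpha)%:E
              <= inner_prob P [set w | forall x, (Lo n w x <= Uo n w x)%R])%E,
         cvg_in_prob P (fun n w =>
           esup0 [set supnorm [set: R] (fun x => G x - F x)
                | G in in_band s (Ln n w) (Un n w)]) 0,
         forall a b : R, a <= b -> `[a, b] `<=` J F ->
           inner_prob P [set w | forall G, in_band s (Ln n w) (Un n w) G ->
             `[a, b] `<=` J G] @[n --> \oo] --> 1%E
           /\
           forall h, h_maps s h ->
             cvg_in_prob P (fun n w =>
               esup0 [set supnorm `[a, b] (fun x => h G x - h F x)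
                    | G in in_band s (Ln n w) (Un n w)]) 0,
         forall x1 b1 : R, J F x1 -> 0 < b1 < derive1 F x1 / F x1 `^ (1 - s) ->
           inner_prob P [set w | forall x x' : R, x <= x' -> x' <= x1 ->
             Uo n w x <= Num.max (Un n w x' `^ s + s * b1 * (x - x')) 0
                           `^ s^-1] @[n --> \oo] --> 1%E &
         forall x2 b2 : R, J F x2 ->
           0 < b2 < derive1 F x2 / (1 - F x2) `^ (1 - s) ->
           inner_prob P [set w | forall x x' : R, x2 <= x' -> x' <= x ->
             1 - Lo n w x <= Num.max ((1 - Ln n w x') `^ s - s * b2 * (x - x')) 0
                               `^ s^-1] @[n --> \oo] --> 1%E]).
Proof.
have dF : distribution_function F.
  by apply: (@cdf_distribution_function _ _ _ P (X 0%N)) => x; case: X_iid.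
split=> [nsF|sF s0].
  apply: mu_ext_cvg0S (mu_ext_band_cvg0 consistent (near_not_Pclass dF F_continuous nsF)).
  by move=> n w /refined_leP[G bG]; exists G.
(* Freezes the point in a joint convergence, so that an open condition on the derivative of [phi(F)]
   or [phi(1 - F)] at [x] passes to all nearby [G]. *)
have near_deriv (H : (R -> R) -> R -> R) (Q : R -> Prop) x :
    H p.2 p.1 @[p --> filter_prod (nbhs x) (Pclass_near s F)] --> H F x ->
    (\forall y \near H F x, Q y) ->
    \forall G \near Pclass_near s F, Q (H G x).
  move=> cH /cH[[A B] /= [nA nB] AB]; apply: filterS nB => G BG.
  by apply: (AB (x, G)); split => //=; exact: nbhs_singleton.
split.
- move=> n n0; have bn := band n n0; have [_ _ _ Pn] := bn.
  have mC := measurable_coverage F_continuous bn.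
  (* Whenever the band covers [F], it contains a member of the class, namely [F]; inner probability
     is monotone and agrees with [P] on the measurable coverage event. *)
  rewrite -Pn -(inner_probE P mC) /inner_prob.
  apply: leeB => //; apply: le_mu_ext; apply: subsetC => w Fw.
  by apply/refined_leP; exists F.
- apply: (esup0_band_cvg0 consistent (D := fun G x => G x - F x)); first by exists 0.
  move=> e e0; apply: filterS (near_Pclass_uniform s F_continuous dF e0).
  by move=> G GF x _.
- move=> a b ab abJ; split.
    apply: (inner_prob_band_cvg1 consistent
      (near_Pclass_J_itv s ab abJ)).
    by [].
  move=> h hh.
  apply: (esup0_band_cvg0 consistent (D := fun G x => h G x - h F x)).
    by exists a; rewrite /= in_itv/= lexx.
  by move=> e e0; exact: near_h_maps_uniform.
- move=> x1 b1 Jx1 /andP[b10 b1F].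
  (* The ratio bounding [b1] is the derivative of [phi(F)] at [x1]. *)
  have b1phi : b1 < derive1 (phi s \o F) x1.
    have dphi := is_derive_phi_Pclass sF s0 Jx1.
    rewrite derive1E derive_val; move: b1F.
    by rewrite mulrC -powRN opprB.
  have near_b1 : \forall G \near Pclass_near s F, b1 < derive1 (phi s \o G) x1.
    apply: (near_deriv (fun G => derive1 (phi s \o G)) (fun y => b1 < y)).
      exact: cvg_joint_phi.
    exact: lt_nbhsr.
  apply: (inner_prob_band_cvg1 consistent (filterI (near_Pclass s F)
    (filterI (near_Pclass_J s Jx1) near_b1))).
  move=> n w bandQ x x' xx' x'x1.
  apply: refined_upper_le; first exact: powR_ge0.
  move=> G bG; have [sG [JG b1G]] := bandQ G bG.
  apply: (Pclass_le_chord s0 sG JG b10 b1G xx' x'x1).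
  by have [_ /(_ x')/andP[]] := bG.
- move=> x2 b2 Jx2 /andP[b20 b2F].
  (* The ratio bounding [b2] is minus the derivative of [phi(1 - F)] at [x2]. *)
  have b2phi : derive1 (phi s \o (fun y => 1 - F y)) x2 < - b2.
    have dphi := is_derive_phi1m_Pclass sF s0 Jx2.
    rewrite derive1E derive_val mulrN ltrN2; move: b2F.
    by rewrite mulrC -powRN opprB.
  have near_b2 : \forall G \near Pclass_near s F,
      derive1 (phi s \o (fun y => 1 - G y)) x2 < - b2.
    apply: (near_deriv (fun G => derive1 (phi s \o (fun y => 1 - G y)))
      (fun y => y < - b2)).
      exact: cvg_joint_phi1m.
    exact: lt_nbhsl.
  apply: (inner_prob_band_cvg1 consistent (filterI (near_Pclass s F)
    (filterI (near_Pclass_J s Jx2) near_b2))).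
  move=> n w bandQ x x' x2x' x'x.
  apply: refined_lower_ge; first exact: powR_ge0.
  move=> G bG; have [sG [JG b2G]] := bandQ G bG.
  apply: (Pclass_ge_chord s0 sG JG b20 b2G x2x' x'x).
  by have [_ /(_ x')/andP[]] := bG.
Qed.
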